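(* Let $n\ge1$, let $n_2$ be the largest power of $2$ dividing $n$, and let $y\in\mathbb{F}_{2^n}$ satisfy $\sum_{i=0}^{n-1}y^{2^i}=0$. There exists $z\in\mathbb{F}_{2^n}$ having absolute trace $\sum_{i=0}^{n-1}z^{2^i}=1$ and degree $n_2$ over $\mathbb{F}_2$. For any such $z$, setting $x_i=\sum_{j=0}^{i-1}z^{2^j}$ for $i\ge0$, the element $$x=\sum_{i=0}^{n-1}x_iy^{2^i}$$ is a root of $t^2+t+y$, and the sequence $(x_i)_{i\ge0}$ has period $2n_2$. Moreover, if $n_2\in\{2,4,8,16,32\}$, then $z$ may be chosen to be a root in $\mathbb{F}_{2^n}$ of the following polynomial $m(t)\in\mathbb{F}_2[t]$, which is the minimal polynomial of $z$ over $\mathbb{F}_2$: - $n_2=2$: $m(t)=t^2+t+1$; - $n_2=4$: $m(t)=t^4+t^3+1$; - $n_2=8$: $m(t)=t^8+t^7+t^2+t+1$; - $n_2=16$: $m(t)=t^{16}+t^{15}+t^8+t+1$; - $n_2=32$: $m(t)=t^{32}+t^{31}+t^3+t+1$.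
   Context: The degree of $z$ over $\mathbb{F}_2$ is $|\mathbb{F}_2(z):\mathbb{F}_2|$. Empty sums are $0$. A sequence $(x_i)_{i\ge0}$ has period $m$ if $x_i=x_j$ whenever $i\equiv j\pmod m$, and $m$ is the minimal positive integer with this property. *)

(* Defs.v *)
From HB Require Import structures.
From mathcomp Require Import all_boot all_order all_algebra all_field.
Set Implicit Arguments.
Unset Strict Implicit.
Unset Printing Implicit Defensive.
Import GRing.Theory.
Local Open Scope ring_scope.

Definition periodic (T : Type) (u : nat -> T) (m : nat) : Prop :=
  forall i j : nat, i = j %[mod m] -> u i = u j.

Definition has_period (T : Type) (u : nat -> T) (m : nat) : Prop :=
  [/\ (0 < m)%N, periodic u m
    & forall k : nat, (0 < k)%N -> periodic u k -> (m <= k)%N].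

(* The field F_(2^n) is represented by an extension L of 'F_2 of dimension n. *)

Definition abs_trace (L : fieldExtType 'F_2) (n : nat) (z : L) : L :=
  \sum_(0 <= i < n) z ^+ (2 ^ i).

(* <<1; z>> is F_2(z), so this is |F_2(z) : F_2|. *)
Definition degree (L : fieldExtType 'F_2) (z : L) : nat := \dim <<1; z>>%VS.

Definition xseq (L : fieldExtType 'F_2) (z : L) (i : nat) : L :=
  \sum_(0 <= j < i) z ^+ (2 ^ j).

Definition xsol (L : fieldExtType 'F_2) (n : nat) (z y : L) : L :=
  \sum_(0 <= i < n) xseq z i * y ^+ (2 ^ i).

(* The largest power of 2 dividing n (in ring_scope, n`_2 would be seq indexing). *)
Definition two_part (n : nat) : nat := (n`_2)%N.

Definition admissible (L : fieldExtType 'F_2) (n : nat) (z : L) : Prop :=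
  abs_trace n z = 1 /\ degree z = two_part n.

Definition admissible_root (L : fieldExtType 'F_2) (n : nat) (m : {poly 'F_2})
    (z : L) : Prop :=
  let mL := map_poly (in_alg L) m in
  [/\ admissible n z, root mL z & minPoly 1 z = mL].

(* Main.v *)
(* Write d = n_2 and T_i = sum_(j < i) z^(2^j), so that T_(i+1) = T_i^2 + z; summing against the
   conjugates of y gives x^2 = x + z Tr(y)^2 + T_n y = x + y.  Since n/d is odd, an element
   z = z^(2^d) has trace T_d, and any z of trace 1 has n/deg z odd, hence d | deg z.  Thus
   z^(2^d) = z and T_d = 1 already force z to be admissible, and T_(i+d) = T_i + 1.
   For a polynomial m of degree d listed in the statement, t^(2^d) = t and
   sum_(i < d) t^(2^i) = 1 are computed in F_2[t]/m.  The first makes m divide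
   t^(2^n) - t, which splits in L; both together make every root admissible, hence of
   degree d, so m is its minimal polynomial without a separate irreducibility test. *)

Require Import Defs.
From HB Require Import structures.
From mathcomp Require Import all_boot all_order all_algebra all_field.
From mathcomp Require Import qpoly ring.
Import GRing.Theory.
Local Open Scope ring_scope.

Set Implicit Arguments.
Unset Strict Implicit.

(** * Frobenius powers in characteristic 2 *)

Lemma exprD_pow2 (A : comNzRingType) (pcharA : 2%N \in [pchar A]) (k : nat) :
  {morph (fun x : A => x ^+ (2 ^ k)) : x y / x + y}.
Proof.
by move=> x y; rewrite exprDn_pchar // pnatX (pnatE _ (isT : prime 2)) pcharA.
Qed.

Lemma expr_sum_pow2 (A : comNzRingType) (pcharA : 2%N \in [pchar A]) (k : nat)
    (I : Type) (r : seq I) (F : I -> A) :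
  (\sum_(i <- r) F i) ^+ (2 ^ k) = \sum_(i <- r) F i ^+ (2 ^ k).
Proof.
by rewrite (big_morph _ (exprD_pow2 pcharA k) (id1 := 0)) // expr0n expn_eq0.
Qed.

Lemma mulrn_pchar2 (A : nzRingType) (pcharA : 2%N \in [pchar A]) (x : A) (m : nat) :
  x *+ m = x *+ odd m.
Proof.
rewrite -{1}(odd_double_half m) mulrnDr -mul2n mulrnA mulr2n.
by rewrite addrr_pchar2 // mul0rn addr0.
Qed.

Lemma expr_pow2_mul (A : nzRingType) (a : A) (d m : nat) :
  a ^+ (2 ^ d) = a -> a ^+ (2 ^ (d * m)) = a.
Proof.
by move=> ad; elim: m => [|m IH]; rewrite ?muln0 ?expr1 // mulnS expnD exprM ad.
Qed.

(** * Partial traces, degrees and admissible elements *)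

Section BinaryExtension.
Variable L : fieldExtType 'F_2.
Implicit Types z w : L.

Lemma pchar2L : 2%N \in [pchar L].
Proof. by rewrite pchar_lalg pchar_Fp. Qed.
Hint Resolve pchar2L : core.

(** After the first [i] terms, what remains is a Frobenius power of a shorter partial trace. The
    cases [j = 1] and [i = 1] give the two recurrences below. *)
Lemma xseqD z i j : xseq z (i + j) = xseq z i + xseq z j ^+ (2 ^ i).
Proof.
rewrite /xseq (big_cat_nat (n := i)) ?leq_addr //=; congr (_ + _).
rewrite expr_sum_pow2 // -{1}[i]add0n big_addn addKn.
by apply: eq_bigr => k _; rewrite -exprM -expnD.
Qed.

Lemma xseq1 z : xseq z 1 = z.
Proof. by rewrite /xseq big_nat1 expr1. Qed.

Lemma xseqS z i : xseq z i.+1 = xseq z i + z ^+ (2 ^ i).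
Proof. by rewrite -[i.+1]addn1 xseqD xseq1. Qed.

Lemma xseqSl z i : xseq z i.+1 = z + xseq z i ^+ 2.
Proof. by rewrite -[i.+1]add1n xseqD xseq1. Qed.

Lemma xseq_exp z i k : xseq (z ^+ (2 ^ k)) i = xseq z i ^+ (2 ^ k).
Proof.
by rewrite /xseq expr_sum_pow2 //; apply: eq_bigr => j _; rewrite -!exprM mulnC.
Qed.

Lemma xseq_sum (I : Type) (r : seq I) (F : I -> L) i :
  xseq (\sum_(k <- r) F k) i = \sum_(k <- r) xseq (F k) i.
Proof.
by rewrite /xseq exchange_big; apply: eq_bigr => j _; rewrite expr_sum_pow2.
Qed.

Lemma xseq_mul z d m : z ^+ (2 ^ d) = z -> xseq z (d * m) = xseq z d *+ m.
Proof.
move=> zd; elim: m => [|m IH]; first by rewrite muln0 /xseq big_nil mulr0n.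
by rewrite mulnS xseqD -xseq_exp zd IH mulrS.
Qed.

Lemma degree_fix z : z ^+ (2 ^ degree z) = z.
Proof.
have := Fermat's_little_theorem <<1; z>>%AS z.
by rewrite memv_adjoin card_Fp // => /esym/eqP.
Qed.

Lemma expr_dim z : z ^+ (2 ^ \dim {:L}) = z.
Proof.
have := Fermat's_little_theorem {:L}%AS z.
by rewrite memvf card_Fp // => /esym/eqP.
Qed.

Lemma degree_gt0 z : (0 < degree z)%N.
Proof. exact: adim_gt0. Qed.

Lemma vspace_roots_leq (V : {vspace L}) (p : {poly L}) :
  p != 0 -> {in V, forall x, root p x} -> (2 ^ \dim V < size p)%N.
Proof.
move=> p0 Vp; pose fL := finvect_type L.
have cardV : size (enum (mem (V : {vspace fL}))) = (2 ^ \dim V)%N.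
  by rewrite -cardE card_vspace card_Fp.
rewrite -cardV; apply: (@max_poly_roots L) => //; last exact: enum_uniq.
by apply/allP => x xV; apply: Vp; move: xV; rewrite (@mem_enum fL).
Qed.

(** Elements of F_2(z) are polynomials in [z] over F_2, so they are all roots of X^(2^k) - X;
    counting roots bounds the dimension. *)
Lemma degree_leq z k : (0 < k)%N -> z ^+ (2 ^ k) = z -> (degree z <= k)%N.
Proof.
move=> k0 zk; have k1 : (1 < 2 ^ k)%N by rewrite -{1}(expn0 2) ltn_exp2l.
have szp : size ('X^(2 ^ k) - 'X : {poly L}) = (2 ^ k).+1.
  by rewrite size_polyDl size_polyXn // size_polyN size_polyX.
rewrite -(leq_exp2l (m := 2)) // -ltnS -szp; apply: vspace_roots_leq.
  by rewrite -size_poly_eq0 szp.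
move=> _ /Fadjoin1_polyP[p ->]; rewrite /root !hornerE subr_eq0.
rewrite horner_coef expr_sum_pow2 //; apply/eqP/eq_bigr => i _.
rewrite exprMn exprAC zk coef_map /= -in_algE -rmorphXn /=.
(* Writing [k] as [1 * k] reduces invariance of a coefficient c to c^2 = c in F_2. *)
rewrite -[k]mul1n expr_pow2_mul // expn1.
by rewrite -{2}[p`_i]expf_card card_Fp.
Qed.

(** A nonzero remainder of [k] modulo the degree would also fix [z], against [degree_leq]. *)
Lemma degree_dvd z k : z ^+ (2 ^ k) = z -> (degree z %| k)%N.
Proof.
move=> zk; set e := degree z; rewrite /dvdn; case: posnP => // r0.
have /(degree_leq r0) : z ^+ (2 ^ (k %% e)) = z.
  rewrite -{2}zk {2}(divn_eq k e) mulnC expnD exprM expr_pow2_mul //.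
  exact: degree_fix.
by rewrite leqNgt ltn_mod degree_gt0.
Qed.

Lemma odd_two_part_compl n : (0 < n)%N -> exists2 m, odd m & n = (two_part n * m)%N.
Proof.
move=> n0; exists (n`_2^')%N; last by rewrite /two_part partnC.
by rewrite odd_2'nat part_pnat.
Qed.

Lemma two_part_gt0 n : (0 < two_part n)%N.
Proof. exact: part_gt0. Qed.

Lemma expr_two_part z n : degree z = two_part n -> z ^+ (2 ^ two_part n) = z.
Proof. by move=> <-; apply: degree_fix. Qed.

Lemma xseq_two_part z n : (0 < n)%N -> z ^+ (2 ^ two_part n) = z ->
  xseq z n = xseq z (two_part n).
Proof.
move=> n0 zd; have [m mo en] := odd_two_part_compl n0.
by rewrite {1}en xseq_mul // (mulrn_pchar2 pchar2L) mo.
Qed.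

Lemma admissibleI n z : \dim {:L} = n -> z ^+ (2 ^ two_part n) = z ->
  xseq z (two_part n) = 1 -> admissible n z.
Proof.
move=> hL zd Td; have n0 : (0 < n)%N by rewrite -hL adim_gt0.
have Tn : xseq z n = 1 by rewrite xseq_two_part.
split=> //; apply/eqP; rewrite eqn_dvd degree_dvd //=.
have /dvdnP[q eq] : (degree z %| n)%N.
  by apply: degree_dvd; rewrite -hL expr_dim.
(* An even quotient would make the trace an even multiple, hence 0 instead of 1. *)
have qodd : odd q.
  apply/negPn/negP => qe; move: Tn; rewrite eq mulnC xseq_mul ?degree_fix //.
  rewrite (mulrn_pchar2 pchar2L) (negbTE qe) mulr0n => /eqP.
  by rewrite eq_sym oner_eq0.
have : (two_part n %| q * degree z)%N by rewrite -eq dvdn_part.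
by rewrite Gauss_dvdr // /two_part p_part coprimeXl ?coprime2n.
Qed.

(** The trace polynomial has degree at most 2^(n-1), too small to vanish on all of [L], and a
    nonzero trace is 1 because it equals its own square. *)
Lemma exists_trace1 n : \dim {:L} = n -> exists w, xseq w n = 1.
Proof.
move=> hL; have n0 : (0 < n)%N by rewrite -hL adim_gt0.
pose p : {poly L} := \sum_(0 <= i < n) 'X^(2 ^ i).
have hp x : p.[x] = xseq x n.
  by rewrite horner_sum; apply: eq_bigr => i _; rewrite hornerXn.
(* The coefficient of X is 1: among the exponents 2^i only i = 0 gives an odd one. *)
have p0 : p != 0.
  apply/eqP => /(congr1 (fun q : {poly L} => q`_1)) /eqP.
  rewrite coef0 coef_sum big_ltn // coefXn /= big_nat_cond big1 ?addr0 ?oner_eq0 //.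
  move=> i /andP[/andP[i0 _] _]; rewrite coefXn.
  case: i i0 => // i _; rewrite expnS mul2n.
  by case: eqP => // /(congr1 odd); rewrite odd_double.
have szp : (size p <= (2 ^ n.-1).+1)%N.
  rewrite /p big_nat_cond; apply: (big_ind (fun q : {poly L} => (size q <= _)%N)).
  - by rewrite size_poly0.
  - by move=> q r hq hr; rewrite (leq_trans (size_polyD _ _)) // geq_max hq.
  move=> i /andP[/andP[_ ilt] _]; rewrite size_polyXn ltnS leq_exp2l //.
  by rewrite -ltnS prednK.
have [/existsP[w Hw]|/existsPn H] := boolP [exists w : finvect_type L, @xseq L w n != 0].
  (* The two recurrences for [xseq w n.+1] together with w^(2^n) = w give T = T^2 for the trace
     T. *)
  exists (w : L); move: (w : L) Hw => {}w Hw; have /eqP := xseqSl w n.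
  rewrite xseqS -{2}hL expr_dim addrC.
  rewrite (inj_eq (addrI _)) -subr_eq0 expr2 -{1}[xseq w n]mulr1 -mulrBr mulf_eq0.
  by rewrite (negbTE Hw) /= subr_eq0 => /eqP.
have : (2 ^ n < size p)%N.
  rewrite -{1}hL; apply: vspace_roots_leq => // x _.
  by rewrite /root hp; apply/negPn/H.
by move=> /leq_trans/(_ szp); rewrite ltnS leq_exp2l // -ltnS prednK // ltnn.
Qed.

Lemma xseq_tower w d m :
  xseq w (d * m) = \sum_(0 <= i < m) xseq w d ^+ (2 ^ (d * i)).
Proof.
elim: m => [|m IH]; first by rewrite muln0 /xseq !big_geq.
by rewrite mulnSr xseqD IH big_nat_recr.
Qed.

(* The witness is the relative trace to F_(2^n_2) of an element of trace 1. *)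
Lemma exists_admissible n : \dim {:L} = n -> exists z, admissible n z.
Proof.
move=> hL; have n0 : (0 < n)%N by rewrite -hL adim_gt0.
have [w Tw] := exists_trace1 hL.
have [m mo en] := odd_two_part_compl n0; set d := two_part n in en *.
pose F i := w ^+ (2 ^ (d * i)).
exists (\sum_(0 <= i < m) F i); apply: admissibleI => //.
  (* Raising to the power 2^d shifts the index of [F] by one, and [F m = F 0], so the sum is only
     permuted cyclically. *)
  have F0 : F 0%N = w by rewrite /F muln0 expr1.
  have Fm : F m = w by rewrite /F -en -hL expr_dim.
  rewrite (expr_sum_pow2 pchar2L).
  under eq_bigr do rewrite -exprM -expnD -mulnSr.
  by apply: (addrI (F 0%N)); rewrite -big_nat_recl // big_nat_recr //= F0 Fm addrC.
rewrite xseq_sum; under eq_bigr do rewrite xseq_exp.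
by rewrite -xseq_tower -en.
Qed.

(** * The quadratic root and the period *)

Lemma xsol_root n y z : \dim {:L} = n -> abs_trace n y = 0 -> abs_trace n z = 1 ->
  root ('X^2 + 'X + y%:P) (xsol n z y).
Proof.
move=> hL Ty Tz; pose F i := xseq z i * y ^+ (2 ^ i).
have F0 : F 0%N = 0 by rewrite /F /xseq big_geq // mul0r.
have Fn : F n = y by rewrite /F [xseq z n]Tz mul1r -hL expr_dim.
(* Squaring shifts the sum by one index, up to [z] times the squared trace of [y]; only the end
   terms [F 0 = 0] and [F n = y] then differ. *)
have sqrF i : F i ^+ 2 = F i.+1 + z * (y ^+ (2 ^ i)) ^+ 2.
  rewrite /F exprMn xseqSl -exprM -expnSr mulrDl addrAC -mulrDl.
  by rewrite (addrr_pchar2 pchar2L) mul0r add0r.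
have sqr_sum G : (\sum_(0 <= i < n) G i) ^+ 2 = \sum_(0 <= i < n) G i ^+ 2 :> L.
  exact: (expr_sum_pow2 pchar2L 1).
have sqrx : xsol n z y ^+ 2 = xsol n z y + y.
  rewrite /xsol sqr_sum; under eq_bigr do rewrite sqrF.
  rewrite big_split /= -big_distrr /= -sqr_sum.
  rewrite [X in X ^+ _]Ty expr0n mulr0 addr0.
  by rewrite -[LHS]add0r -{1}F0 -big_nat_recl // big_nat_recr //= Fn.
by rewrite /root !hornerE sqrx -addrA (addrr_pchar2 pchar2L).
Qed.

(** Two blocks of length [d] contribute 1 + 1 = 0. Conversely a period [k] gives T_k = T_0 = 0 and
    z^(2^k) = T_(k+1) - T_k = z, so [d] divides [k], with even quotient since T_k = 0. *)
Lemma xseq_period n z : (0 < n)%N -> admissible n z ->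
  has_period (xseq z) (2 * two_part n)%N.
Proof.
move=> n0 [Tz ez]; set d := two_part n in ez *.
have d0 : (0 < d)%N by apply: two_part_gt0.
have zd : z ^+ (2 ^ d) = z by apply: expr_two_part.
have Td : xseq z d = 1 by rewrite -xseq_two_part.
have Tmul k : xseq z (d * k) = (odd k)%:R by rewrite xseq_mul // Td (mulrn_pchar2 pchar2L).
split; first by rewrite muln_gt0.
  suff per i : xseq z i = xseq z (i %% (2 * d)).
    by move=> i j ij; rewrite per ij -per.
  rewrite {1}(divn_eq i (2 * d)) [(_ * (2 * d))%N]mulnC [(2 * d)%N]mulnC -mulnA xseqD Tmul.
  by rewrite mul2n odd_double add0r -xseq_exp expr_pow2_mul.
move=> k k0 per.
have Tk : xseq z k = 0.
  by rewrite (per k 0%N) ?modnn ?mod0n // /xseq big_geq.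
have : z ^+ (2 ^ k) = z.
  have := xseqS z k; rewrite Tk add0r => <-.
  by rewrite (per k.+1 1%N) ?xseq1 // -addn1 modnDl.
move=> /degree_dvd; rewrite ez => /dvdnP[q eq].
move: Tk k0; rewrite eq [(q * d)%N]mulnC Tmul muln_gt0 d0 /= [(2 * d)%N]mulnC leq_pmul2l //.
by case: q {eq} => [|[|q]] //= /eqP; rewrite oner_eq0.
Qed.
End BinaryExtension.

(* Polynomials over F_2 as lists of bits, lowest degree first. *)
Definition bits_eval (A : nzRingType) (s : bitseq) (a : A) : A :=
  foldr (fun (b : bool) r => r * a + b%:R) 0 s.

Definition bits_poly (R : nzRingType) (s : bitseq) : {poly R} :=
  Poly [seq b%:R | b : bool <- s].

Fixpoint bits_add (s t : bitseq) : bitseq :=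
  match s, t with
  | [::], _ => t
  | _, [::] => s
  | b :: s', c :: t' => (b (+) c) :: bits_add s' t'
  end.

Definition bits_sqr (s : bitseq) : bitseq :=
  foldr (fun b r => b :: false :: r) [::] s.

(* Without trimming, repeated squaring would double the length of the list at each step. *)
Definition bits_trim (s : bitseq) : bitseq :=
  foldr (fun b r => if b || ~~ nilp r then b :: r else [::]) [::] s.

Definition bits_cancel (m s : bitseq) : bitseq :=
  bits_trim (if nth false s (size m).-1 then bits_add s m else s).

(** Horner-style division: prefixing a bit to a reduced remainder raises its degree at most to that
    of [m], so one cancellation restores it. *)
Definition bits_mod (m s : bitseq) : bitseq :=
  foldr (fun b r => bits_cancel m (b :: r)) [::] s.

(* t^(2^i) modulo m. *)
Definition bits_frob (m : bitseq) (i : nat) : bitseq :=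
  iter i (fun s => bits_mod m (bits_sqr s)) [:: false; true].

(** In characteristic 2 equality means a vanishing sum; this form ignores trailing zeros. *)
Definition bits_eq (s t : bitseq) : bool := ~~ has id (bits_add s t).

(** Boolean, so that it is decided by evaluation. The first two conditions make the polynomial monic
    of degree [d]. *)
Definition bits_cert (m : bitseq) (d : nat) : bool :=
  [&& size m == d.+1, last false m, bits_eq (bits_frob m d) [:: false; true]
    & bits_eq (foldr bits_add [::] [seq bits_frob m i | i <- iota 0 d]) [:: true]].

(** Links the coefficient form, from which size and monicity are read, to the Horner form, which
    [ring] can normalise. *)
Lemma bits_polyE (R : nzRingType) (s : bitseq) : bits_poly R s = bits_eval s 'X.
Proof.
by elim: s => //= b s IH; rewrite /bits_poly /= cons_poly_def -/(bits_poly R s) IH polyC_natr.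
Qed.

Lemma rmorph_bits_eval (A B : nzRingType) (f : {rmorphism A -> B}) s (a : A) :
  f (bits_eval s a) = bits_eval s (f a).
Proof.
by elim: s => [|b s IH] /=; rewrite ?rmorph0 // rmorphD rmorphM rmorph_nat IH.
Qed.

Lemma horner_bits_poly (R : comNzRingType) s (a : R) : (bits_poly R s).[a] = bits_eval s a.
Proof. by rewrite horner_Poly; elim: s => //= b s ->. Qed.

Lemma map_bits_poly (R S : nzRingType) (f : {rmorphism R -> S}) s :
  map_poly f (bits_poly R s) = bits_poly S s.
Proof. by rewrite !bits_polyE rmorph_bits_eval /= map_polyX. Qed.

(** * Soundness of the bit arithmetic *)

Section BitsChar2.
Variables (A : comNzRingType) (pcharA : 2%N \in [pchar A]) (a : A).

Lemma bits_eval_add s t : bits_eval (bits_add s t) a = bits_eval s a + bits_eval t a.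
Proof.
elim: s t => [|b s IH] [|c t] /=; rewrite ?add0r ?addr0 // IH mulrDl addrACA.
by congr (_ + _); case: b c => [] [] /=; rewrite ?add0r ?addr0 ?(addrr_pchar2 pcharA).
Qed.

Lemma bits_eval_sqr s : bits_eval (bits_sqr s) a = bits_eval s a ^+ 2.
Proof.
elim: s => [|b s IH] /=; first by rewrite expr0n.
rewrite IH addr0 -mulrA -expr2 -exprMn; have /= -> := exprD_pow2 pcharA 1.
by congr (_ + _); case: b; rewrite ?expr1n ?expr0n.
Qed.

Lemma bits_eval_trim s : bits_eval (bits_trim s) a = bits_eval s a.
Proof.
elim: s => //= b s <-; case: b (bits_trim s) => [|] [|c t] //=.
by rewrite mul0r addr0.
Qed.

(** Each cancellation adds either nothing or [m], whose value at [a] is 0. The element [a] will be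
    first the class of X in a quotient ring, then a root in [L]. *)
Lemma bits_eval_mod m s : bits_eval m a = 0 -> bits_eval (bits_mod m s) a = bits_eval s a.
Proof.
move=> ma; elim: s => //= b s IH; rewrite /bits_cancel bits_eval_trim.
by case: ifP => _; rewrite ?bits_eval_add ?ma ?addr0 /= IH.
Qed.

Lemma bits_eval_frob m i : bits_eval m a = 0 -> bits_eval (bits_frob m i) a = a ^+ (2 ^ i).
Proof.
move=> ma; elim: i => [|i IH] /=; first by rewrite mul0r add0r mul1r addr0.
by rewrite bits_eval_mod // bits_eval_sqr IH expnSr exprM.
Qed.

Lemma bits_eval_eq s t : bits_eq s t -> bits_eval s a = bits_eval t a.
Proof.
move=> st; apply/eqP; rewrite -subr_eq0 (oppr_pchar2 pcharA) -bits_eval_add; apply/eqP.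
move: st; rewrite /bits_eq; elim: (bits_add s t) => //= b r IH.
by rewrite negb_or => /andP[/negbTE-> /IH->]; rewrite mul0r addr0.
Qed.

Lemma bits_cert_frob m d : bits_cert m d -> bits_eval m a = 0 -> a ^+ (2 ^ d) = a.
Proof.
move=> /and4P[_ _ /bits_eval_eq + _] ma; rewrite bits_eval_frob // => ->.
by rewrite /= mul0r add0r mul1r addr0.
Qed.

Lemma bits_cert_trace m d : bits_cert m d -> bits_eval m a = 0 ->
  \sum_(0 <= i < d) a ^+ (2 ^ i) = 1.
Proof.
move=> /and4P[_ _ _ /bits_eval_eq] /[swap] ma.
rewrite /= mul0r add0r mulr1n => <-; rewrite /index_iota subn0.
elim: (iota 0 d) => [|i r IH] /=; first by rewrite big_nil.
by rewrite big_cons bits_eval_add IH bits_eval_frob.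
Qed.

End BitsChar2.

Lemma bits_cert_polyseq (R : nzRingType) m d : bits_cert m d ->
  bits_poly R m = [seq b%:R | b : bool <- m] :> seq R.
Proof.
move=> /and4P[_ lm _ _]; apply: (PolyK (c := 0)).
by rewrite (last_map (fun b : bool => b%:R : R) m false) lm oner_eq0.
Qed.

Lemma bits_cert_size (R : nzRingType) m d : bits_cert m d -> size (bits_poly R m) = d.+1.
Proof.
by move=> hc; rewrite (bits_cert_polyseq R hc) size_map; case/and4P: hc => /eqP.
Qed.

Lemma bits_cert_monic (R : nzRingType) m d : bits_cert m d -> bits_poly R m \is monic.
Proof.
move=> hc; rewrite monicE lead_coefE (bits_cert_polyseq R hc) nth_last.
apply/eqP/(etrans (last_map (fun b : bool => b%:R : R) m false)).
by case/and4P: hc => _ ->.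
Qed.

(** The quotient is taken by [mk_monic h], which is [h] itself only for [h] monic and
    nonconstant. *)
Lemma in_qpoly_eq0 (F : fieldType) (h p : {poly F}) : h \is monic -> (1 < size h)%N ->
  (in_qpoly h p == 0) = (h %| p).
Proof.
move=> hm hs; have hmk : mk_monic h = h by rewrite /mk_monic hs hm.
by apply/eqP/idP => [/val_eqP|hp]; last apply/val_eqP;
  rewrite /= -Pdiv.IdomainMonic.modpE hmk.
Qed.

(** * Roots in [L] of certified polynomials *)

Section Roots.
Variable L : fieldExtType 'F_2.

(** The hypothesis on ['qX] says that [h] divides X^(2^n) - X, the product of all X - x with x in
    [L]; a nonconstant divisor keeps one of these factors. *)
Lemma exists_root_qX n (h : {poly L}) : \dim {:L} = n -> h \is monic ->
  (1 < size h)%N -> ('qX : {poly %/ h}) ^+ (2 ^ n) = 'qX -> exists z, root h z.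
Proof.
move=> hL hm hs hX; pose fL := finvect_type L.
have cardL : #|fL| = (2 ^ n)%N.
  rewrite -hL -[X in (X ^ _)%N](card_Fp (isT : prime 2)) -(@card_vspace _ fL) //.
  by apply: eq_card => x; rewrite memvf.
have : h %| 'X^(2 ^ n) - 'X.
  by rewrite -in_qpoly_eq0 // rmorphB rmorphXn /= -/(qpolyX h) hX subrr.
have -> : 'X^(2 ^ n) - 'X = \prod_(x : fL) ('X - (x : L)%:P) :> {poly L}.
  by rewrite -cardL; apply: (finField_genPoly fL).
case/dvdp_prod_XsubC => b; case: (mask b _) => [|x s] hb.
  by move: hs; rewrite (eqp_size hb) big_nil size_poly1.
by exists x; rewrite (eqp_root hb) big_cons rootM root_XsubC eqxx.
Qed.

Lemma exists_admissible_root n m d : \dim {:L} = n -> two_part n = d -> bits_cert m d ->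
  exists z : L, admissible_root n (bits_poly 'F_2 m) z.
Proof.
move=> hL hd hc; rewrite /admissible_root map_bits_poly.
set h := bits_poly L m; have d0 : (0 < d)%N by rewrite -hd two_part_gt0.
have hm : h \is monic := bits_cert_monic L hc.
have hs : size h = d.+1 := bits_cert_size L hc.
have hs1 : (1 < size h)%N by rewrite hs.
have ch := pchar2L L.
have [z hz] : exists z, root h z.
  apply: (exists_root_qX hL) => //.
  have cq : 2%N \in [pchar {poly %/ h}] by rewrite pchar_qpoly.
  (* First use of the certificate, at the class of X modulo [h], which is a root of [h] by
     construction. *)
  have : bits_eval m ('qX : {poly %/ h}) = 0.
    by rewrite -[LHS]rmorph_bits_eval -bits_polyE; apply/eqP; rewrite in_qpoly_eq0.
  move/(bits_cert_frob cq hc); rewrite -hd => hX.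
  have n0 : (0 < n)%N by rewrite -hL adim_gt0.
  by have [k _ en] := odd_two_part_compl n0; rewrite en; apply: expr_pow2_mul.
exists z; have ez : bits_eval m z = 0 by rewrite -horner_bits_poly; apply/eqP.
(* Second use of the certificate, at the root [z] in [L]. *)
have az : admissible n z.
  apply: admissibleI; rewrite ?hd //; first exact: (bits_cert_frob ch hc ez).
  exact: (bits_cert_trace ch hc ez).
split=> //; apply/eqP; rewrite -eqp_monic ?monic_minPoly //.
(* The minimal polynomial divides [h], and both have degree [d] because [z] is admissible. *)
rewrite -dvdp_size_eqp.
  rewrite hs size_minPoly; have := dim_Fadjoin 1 z; rewrite dimv1 muln1 => <-.
  by have [_ ez'] := az; rewrite -/(degree z) ez' hd.
apply: minPoly_dvdp => //; rewrite /h -(map_bits_poly (in_alg L)).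
by apply/alg_polyOver.
Qed.

End Roots.

Theorem lemma4p9 (n : nat) (hn : (1 <= n)%N)
    (L : fieldExtType 'F_2) (hL : \dim {:L} = n)
    (y : L) (hy : abs_trace n y = 0) :
  [/\ exists z : L, admissible n z,
      forall z : L, admissible n z ->
        root ('X^2 + 'X + y%:P) (xsol n z y) /\ has_period (xseq z) (2 * two_part n)%N
    & [/\ two_part n = 2%N ->
            exists z : L, admissible_root n ('X^2 + 'X + 1) z,
          two_part n = 4%N ->
            exists z : L, admissible_root n ('X^4 + 'X^3 + 1) z,
          two_part n = 8%N ->
            exists z : L, admissible_root n ('X^8 + 'X^7 + 'X^2 + 'X + 1) z,
          two_part n = 16%N ->
            exists z : L, admissible_root n ('X^16 + 'X^15 + 'X^8 + 'X + 1) z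
        & two_part n = 32%N ->
            exists z : L, admissible_root n ('X^32 + 'X^31 + 'X^3 + 'X + 1) z]].
Proof.
have bits m p d : bits_poly 'F_2 m = p -> bits_cert m d -> two_part n = d ->
    exists z : L, admissible_root n p z.
  by move=> <- hc hd; apply: exists_admissible_root hc.
split; first exact: exists_admissible.
  move=> z hz; split; last exact: xseq_period.
  by apply: xsol_root => //; case: hz.
split=> hd.
- apply: (bits [:: true; true; true] _ _ _ _ hd); last by vm_compute.
  by rewrite bits_polyE /=; ring.
- apply: (bits [:: true; false; false; true; true] _ _ _ _ hd); last by vm_compute.
  by rewrite bits_polyE /=; ring.
- apply: (bits ([:: true; true; true] ++ nseq 4 false ++ [:: true; true]) _ _ _ _ hd);
    last by vm_compute.
  by rewrite bits_polyE /=; ring.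
- apply: (bits ([:: true; true] ++ nseq 6 false ++ true :: nseq 6 false ++ [:: true; true])
    _ _ _ _ hd); last by vm_compute.
  by rewrite bits_polyE /=; ring.
apply: (bits ([:: true; true; false; true] ++ nseq 27 false ++ [:: true; true])
  _ _ _ _ hd); last by vm_compute.
by rewrite bits_polyE /=; ring.
Qed.
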